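(* The only possible defective eigenvalue of an antidiagonalizable complex matrix is $0$. Equivalently, if an antidiagonalizable complex matrix is nonsingular, then it is diagonalizable.
   Context: A matrix is antidiagonal if its only nonzero entries are at positions $(i,n+1-i)$, and antidiagonalizable if it is similar to an antidiagonal matrix. An eigenvalue is defective if its geometric multiplicity is strictly less than its algebraic multiplicity. *)

(* Defs.v *)
From HB Require Import structures.
From mathcomp Require Import all_boot all_order all_algebra.
From mathcomp Require Import reals complex.

Set Implicit Arguments.
Unset Strict Implicit.
Unset Printing Implicit Defensive.

Import Order.TTheory GRing.Theory Num.Theory.
Local Open Scope ring_scope.

(* Indices are 0-based: position (i, n + 1 - i) becomes (i, rev_ord i),
   since rev_ord i = n - i.+1. *)
Definition is_antidiag_mx (F : fieldType) (n : nat) (A : 'M[F]_n) : bool :=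
  [forall i, forall j, (j != rev_ord i) ==> (A i j == 0)].

(* The analogue of the library's diagonalizable A, which stands for
   similar_in_to unitmx A is_diag_mx. *)
Definition antidiagonalizable (F : fieldType) (n : nat) (A : 'M[F]_n) : Prop :=
  similar_in_to unitmx A (@is_antidiag_mx F n).

(* eigenspace A a is spanned by row eigenvectors (u *m A = a *: u); its
   dimension equals that of the space of column eigenvectors. *)
Definition geometric_multiplicity (F : fieldType) (n : nat) (A : 'M[F]_n)
  (a : F) : nat := \rank (eigenspace A a).

Definition algebraic_multiplicity (F : fieldType) (n : nat) (A : 'M[F]_n)
  (a : F) : nat := mup a (char_poly A).

Definition defective_eigenvalue (F : fieldType) (n : nat) (A : 'M[F]_n)
  (a : F) : bool :=
  eigenvalue A a &&
  (geometric_multiplicity A a < algebraic_multiplicity A a)%N.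

(* Main.v *)
(** The square of an antidiagonal matrix is diagonal, so an antidiagonalizable
    A has a diagonalizable square. If a != 0, then A - a and A + a have no
    common kernel, and v (A - a)^2 = 0 gives v (A^2 - a^2)^2 = 0, hence
    v (A^2 - a^2) = 0: the vector v (A - a) is killed by both A - a and A + a,
    so it vanishes, which makes a semisimple. If A is nonsingular, each row
    eigenvector p of A^2 has an eigenvalue s^2 != 0 and is a combination of
    p A + s p and p A - s p, which A scales by s and - s. *)
Require Import Defs.
From HB Require Import structures.
From mathcomp Require Import all_boot all_order all_algebra.
From mathcomp Require Import reals complex.

Set Implicit Arguments.
Unset Strict Implicit.
Unset Printing Implicit Defensive.

Import Order.TTheory GRing.Theory Num.Theory.
Local Open Scope ring_scope.
Local Open Scope complex_scope.

Section Field.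
Variable F : fieldType.

(* The sizes m and n are kept apart so that P can be a block column. *)
Lemma char_poly_conj m n (P : 'M[F]_(m, n)) (A : 'M_n) (B : 'M_m) :
  m = n -> row_free P -> P *m A = B *m P -> char_poly A = char_poly B.
Proof.
move=> mn; subst m; rewrite row_free_unit => Pu PA.
pose Q := map_mx polyC P.
have QE : Q *m char_poly_mx A = char_poly_mx B *m Q.
  by rewrite mulmxBr mulmxBl -!map_mxM PA scalar_mxC.
have /(congr1 determinant) := QE.
rewrite !det_mulmx [RHS]mulrC => /mulfI; apply.
by rewrite det_map_mx polyC_eq0 -unitfE -unitmxE.
Qed.

(* The space splits as ker (A - a) + im (A - a); A acts as a on the first
   summand and without eigenvalue a on the second. *)
Lemma semisimple_multiplicity n (A : 'M[F]_n) (a : F) :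
  (kermx ((A - a%:M) *m (A - a%:M)) <= eigenspace A a)%MS ->
  algebraic_multiplicity A a = geometric_multiplicity A a.
Proof.
rewrite /algebraic_multiplicity /geometric_multiplicity /eigenspace.
set N := A - a%:M => kerNN.
(* If [v = w *m N] is killed by [N], then [w] is killed by [N *m N], hence by [N] according to
   [kerNN], so [v = 0]. *)
have capKN : (kermx N :&: N)%MS = 0.
  apply/eqP/rowV0P => v; rewrite sub_capmx => /andP[vK /submxP[w vw]].
  have /eqP : v *m N = 0 by apply/sub_kermxP.
  rewrite vw -mulmxA -sub_kermx => /submx_trans/(_ kerNN).
  by move=> /sub_kermxP.
pose K := row_base (kermx N); pose I := row_base N.
have KA : K *m A = a%:M *m K.
  by rewrite mul_scalar_mx; apply/eigenspaceP; rewrite eq_row_base.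
have [C IA] : exists C, I *m A = C *m I.
  apply/submxP; rewrite eq_row_base.
  have -> : A = N + a%:M by rewrite subrK.
  rewrite mulmxDr addmx_sub ?submxMl //.
  by rewrite scalar_mxC (submx_trans (submxMl _ _)) ?eq_row_base.
have ranks : (\rank (kermx N) + \rank N)%N = n.
  by rewrite mxrank_ker subnK ?rank_leq_row.
have Pfree : row_free (col_mx K I).
  rewrite /row_free -addsmxE (adds_eqmx (eq_row_base _) (eq_row_base _)).
  by rewrite mxrank_disjoint_sum.
have PA : col_mx K I *m A = block_mx a%:M 0 0 C *m col_mx K I.
  by rewrite mul_col_mx mul_block_col !mul0mx addr0 add0r KA IA.
rewrite (char_poly_conj ranks Pfree PA) /char_poly char_block_diag_mx.
rewrite det_ublock -!/(char_poly _) char_poly_trig ?scalar_mx_is_trig //.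
rewrite (eq_bigr (fun=> 'X - a%:P)); last by move=> i _; rewrite mxE eqxx.
rewrite prodr_const card_ord mupMl ?mup_XsubCX ?eqxx //.
(* It remains to see that [a] is not a root of [char_poly C]: an eigenvector [v] would put [v *m I]
   in the zero space [kermx N :&: N], although the rows of [I] are independent. *)
rewrite -eigenvalue_root_char; apply/negP => /eigenvalueP[v vC v0].
have vIK : v *m I *m N = 0.
  by rewrite mulmxBr -mulmxA IA mulmxA vC scalar_mxC mul_scalar_mx
    scalemxAl subrr.
have : (v *m I <= kermx N :&: N)%MS.
  by rewrite sub_capmx sub_kermx vIK eqxx -(eq_row_base N) submxMl.
rewrite capKN submx0 => /eqP vI0.
by case/negP: v0; rewrite -(mulmxKp (row_base_free N) v) vI0 mul0mx.
Qed.

(** In eigenbasis coordinates, [A - c%:M] multiplies each entry by a scalar, and in a field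
    [x * d * d = 0] forces [x * d = 0]. *)
Lemma diagonalizable_semisimple n (A : 'M[F]_n) (c : F) (v : 'rV_n) :
  diagonalizable A -> v *m (A - c%:M) *m (A - c%:M) = 0 ->
  v *m (A - c%:M) = 0.
Proof.
move=> [P Pu /similar_diagPex[d /(similarP Pu) PA]].
pose D := diag_mx (d - const_mx c).
have PD : P *m (A - c%:M) = D *m P.
  by rewrite mulmxBr PA /D linearB /= diag_const_mx mulmxBl scalar_mxC.
have -> : v = v *m invmx P *m P by rewrite mulmxKV.
set w := v *m invmx P.
rewrite -[_ *m P *m _]mulmxA PD mulmxA -[_ *m P *m _]mulmxA PD mulmxA.
move=> /(congr1 (mulmx^~ (invmx P))); rewrite mul0mx mulmxK //.
rewrite /D !mul_mx_diag => /rowP wD0; apply/eqP.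
have -> : \matrix_(i, j) (w i j * (d - const_mx c) 0 j) = 0; last first.
  by rewrite mul0mx.
apply/rowP => j; have := wD0 j; rewrite !mxE => /eqP.
by rewrite mulf_eq0 => /orP[/eqP //|/eqP ->]; rewrite mulr0.
Qed.

(** A path from [i] through two nonzero entries must go to [rev_ord i] and then back to [i], as
    [rev_ord] is an involution. *)
Lemma antidiag_mulmx n (B : 'M[F]_n) :
  is_antidiag_mx B -> is_diag_mx (B *m B).
Proof.
move=> /forallP Banti.
have B0 i j : j != rev_ord i -> B i j = 0.
  by move=> ji; apply/eqP; move/forallP/(_ j)/implyP: (Banti i); apply.
apply/is_diag_mxP => i j ij; rewrite mxE big1 // => k _.
have [->|ki] := eqVneq k (rev_ord i); last by rewrite B0 ?mul0r.
by rewrite (B0 (rev_ord i)) ?mulr0 // rev_ordK eq_sym.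
Qed.

Lemma antidiagonalizable_sqr n (A : 'M[F]_n) :
  antidiagonalizable A -> diagonalizable (A *m A).
Proof.
move=> [P Pu PA]; exists P => //; move: PA; rewrite /similar_to.
by rewrite !conjumx // => /antidiag_mulmx; rewrite !mulmxA mulmxKV.
Qed.

Lemma sqr_diagonalizable_multiplicity n (A : 'M[F]_n) (a : F) :
  2 != 0 :> F -> a != 0 -> diagonalizable (A *m A) ->
  algebraic_multiplicity A a = geometric_multiplicity A a.
Proof.
move=> two0 a0 dA; apply: semisimple_multiplicity; apply/row_subP => i.
set v := row i _; set N := A - a%:M.
have vNN : v *m N *m N = 0 by rewrite -mulmxA; apply/sub_kermxP/row_sub.
have factNM : A *m A - (a ^+ 2)%:M = N *m (A + a%:M).
  rewrite mulmxBl !mulmxDr -scalar_mxM scalar_mxC opprD addrA.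
  by rewrite addrK.
have factMN : A *m A - (a ^+ 2)%:M = (A + a%:M) *m N.
  rewrite mulmxBr !mulmxDl -scalar_mxM -scalar_mxC opprD addrA.
  by rewrite addrK.
(* The two factorizations let [N] move past [A + a%:M], so that both factors [N] of the squared
   product meet [v] and [vNN] applies. *)
have vNM : v *m N *m (A + a%:M) = 0.
  rewrite -mulmxA -factNM; apply: diagonalizable_semisimple => //.
  rewrite factNM !mulmxA -(mulmxA (v *m N) _ N) -factMN factNM mulmxA vNN.
  by rewrite !mul0mx.
apply/sub_kermxP; rewrite -/N.
(* The scalar [2 * a] is the difference of two matrices that both kill [v *m N]. *)
have : (2 * a) *: (v *m N) = 0.
  rewrite -mul_mx_scalar; have -> : (2 * a)%:M = (A + a%:M) - N.
    by rewrite mulr_natl mulr2n raddfD /= [RHS]addrC opprB addrA subrK.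
  by rewrite mulmxBr vNM vNN subr0.
by move/eqP; rewrite scaler_eq0 mulf_eq0 (negPf two0) (negPf a0) => /eqP.
Qed.

End Field.

Lemma unitmx_sqr_diagonalizable (C : numClosedFieldType) n (A : 'M[C]_n) :
  A \in unitmx -> diagonalizable (A *m A) -> diagonalizable A.
Proof.
move=> Au [P Pu /similar_diagPex[d /(similarP Pu) PAA]].
have d0 i : d 0 i != 0.
  have : diag_mx d \in unitmx.
    have -> : diag_mx d = P *m (A *m A) *m invmx P by rewrite PAA mulmxK.
    by rewrite !unitmx_mul Pu Au unitmx_inv Pu.
  by rewrite unitmxE det_diag unitfE => /prodf_neq0; apply.
pose s i := sqrtC (d 0 i).
(* Different [i] may share a square root, while [diagonalizablePeigen] asks for distinct
   eigenvalues. *)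
pose rs := undup ([seq s i | i <- enum 'I_n] ++ [seq - s i | i <- enum 'I_n]).
have sub_eigen r : r \in rs ->
    (eigenspace A r <= \sum_(r <- rs) eigenspace A r)%MS.
  by move=> rrs; rewrite (big_rem r) //= addsmxSl.
apply/diagonalizablePeigen; exists rs; first exact: undup_uniq.
apply/eqmxP; rewrite submx1 /=.
apply: (@submx_trans _ _ _ _ _ _ P).
  by rewrite sub1mx row_full_unit.
apply/row_subP => i; set p := row i P.
have pAA : p *m A *m A = s i ^+ 2 *: p.
  by rewrite -mulmxA -row_mul PAA row_mul row_diag_mx -scalemxAl -rowE sqrtCK.
have s2 : s i + s i != 0 by rewrite -mulr2n mulrn_eq0 sqrtC_eq0 d0.
have -> : p = (s i + s i)^-1 *: ((p *m A + s i *: p) - (p *m A - s i *: p)).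
  rewrite [X in _ *: X]addrC opprB addrA subrK.
  by rewrite -scalerDl scalerA mulVf ?scale1r.
(* Either vector may be zero, so only membership in an eigenspace is claimed. *)
rewrite scalemx_sub // addmx_sub ?eqmx_opp //.
- apply: submx_trans (sub_eigen (s i) _).
    apply/eigenspaceP; rewrite mulmxDl pAA -scalemxAl scalerDr scalerA -expr2.
    by rewrite addrC.
  by rewrite mem_undup mem_cat map_f ?mem_enum.
- apply: submx_trans (sub_eigen (- s i) _).
    apply/eigenspaceP; rewrite mulmxBl pAA -scalemxAl scalerBr scalerA.
    by rewrite mulNr !scaleNr opprK addrC -expr2.
  by rewrite mem_undup mem_cat (map_f (fun i => - s i)) ?mem_enum ?orbT.
Qed.

Theorem corollary5p12 (R : realType) :
  (forall (n : nat) (A : 'M[R[i]]_n) (a : R[i]),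
     antidiagonalizable A -> defective_eigenvalue A a -> a = 0) /\
  (forall (n : nat) (A : 'M[R[i]]_n),
     antidiagonalizable A -> A \in unitmx -> diagonalizable A).
Proof.
have two0 : 2 != 0 :> R[i] by rewrite pnatr_eq0.
split=> [n A a /antidiagonalizable_sqr dA | n A /antidiagonalizable_sqr dA Au].
- move=> /andP[_]; apply: contraTeq => a0.
  by rewrite (sqr_diagonalizable_multiplicity two0 a0 dA) ltnn.
- exact: unitmx_sqr_diagonalizable.
Qed.
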